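(* There exist real Hausdorff locally convex topological vector spaces $X,Y$, a generalized polyhedral convex function $\varphi:X\times Y\to\overline{\mathbb R}$, a generalized polyhedral convex set-valued map $G:X\rightrightarrows Y$, a point $\bar x\in X$ with $\mu(\bar x)\in\mathbb R$ and a point $\bar y\in M(\bar x)$, where $\mu(x)=\inf\{\varphi(x,y)\mid y\in G(x)\}$ and $M(x)=\{y\in G(x)\mid\mu(x)=\varphi(x,y)\}$, such that $$A\subset\partial\mu(\bar x)=B,\quad A\ne B,$$ and $$A^\infty\subset\partial^\infty\mu(\bar x)=B^\infty,\quad A^\infty\neq B^\infty,$$ where $$A=\overline{\bigcup_{(x^*,y^* )\in\partial\varphi(\bar x,\bar y)}\{x^*+D^*G(\bar x,\bar y)(y^* )\}},\qquad B=\mathrm{pr}_{X^*}\Big[\overline{\partial\varphi(\bar x,\bar y)+N((\bar x,\bar y);\mathrm{gph}\,G)}\cap(X^*\times\{0\})\Big],$$ $$A^\infty=\overline{\bigcup_{(x^*,y^* )\in\partial^\infty\varphi(\bar x,\bar y)}\{x^*+D^*G(\bar x,\bar y)(y^* )\}},\qquad B^\infty=\mathrm{pr}_{X^*}\Big[\overline{\partial^\infty\varphi(\bar x,\bar y)+N((\bar x,\bar y);\mathrm{gph}\,G)}\cap(X^*\times\{0\})\Big].$$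
   Context: $\overline{\mathbb R}=\mathbb R\cup\{\pm\infty\}$, $\inf\emptyset=+\infty$. Dual spaces $X^*$, $Y^*$ carry the weak$^*$ topology, $(X\times Y)^*$ is identified with $X^*\times Y^*$, and an overline over a subset of a dual space is the weak$^*$ closure. $\mathrm{pr}_{X^*}:X^*\times Y^*\to X^*$, $(x^*,y^* )\mapsto x^*$. For $f:Z\to\overline{\mathbb R}$, $\mathrm{epi}\,f=\{(z,\lambda)\in Z\times\mathbb R\mid f(z)\le\lambda\}$; $f$ is convex if $\mathrm{epi}\,f$ is convex. For a set-valued map, $\mathrm{gph}\,G=\{(x,y)\mid y\in G(x)\}$. A subset $D$ of a real Hausdorff locally convex space $Z$ is a generalized polyhedral convex set if $D=\{z\in L\mid \langle z_i^*,z\rangle\le\alpha_i,\ i=1,\dots,p\}$ for some $z_i^*\in Z^*$, $\alpha_i\in\mathbb R$, and some closed affine subspace $L\subset Z$. A function (resp. set-valued map) is generalized polyhedral convex if its epigraph (resp. its graph) is a generalized polyhedral convex set. Normal cone to a convex set $C$: $N(\bar z;C)=\{z^*\mid\langle z^*,z-\bar z\rangle\le0\ \forall z\in C\}$ if $\bar z\in C$, and $\emptyset$ otherwise. For convex $f$ with $f(\bar z)\in\mathbb R$: $\partial f(\bar z)=\{z^*\mid\langle z^*,z-\bar z\rangle\le f(z)-f(\bar z)\ \forall z\in Z\}$ and $\partial^\infty f(\bar z)=\{z^*\mid(z^*,0)\in N((\bar z,f(\bar z));\mathrm{epi}\,f)\}$; both are $\emptyset$ if $f(\bar z)\notin\mathbb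 R$. Coderivative of a convex set-valued map $G$ (one with convex graph) at $(\bar x,\bar y)\in\mathrm{gph}\,G$: $D^*G(\bar x,\bar y)(y^* )=\{x^*\in X^*\mid(x^*,-y^* )\in N((\bar x,\bar y);\mathrm{gph}\,G)\}$ for $y^*\in Y^*$. *)

(* Defs.v *)
From HB Require Import structures.
From mathcomp Require Import all_boot all_order all_algebra.
From mathcomp Require Import all_classical all_reals ereal topology normedtype.
Set Implicit Arguments.
Unset Strict Implicit.
Unset Printing Implicit Defensive.
Import Order.TTheory GRing.Theory Num.Theory.
Import numFieldNormedType.Exports.
Local Open Scope classical_set_scope.
Local Open Scope ring_scope.

(* [tvsType R] is the type of locally convex topological vector spaces over R,
   not assumed Hausdorff. *)

Section Dual.
Context {R : realType} (Z : tvsType R).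

Definition dual_pred : {pred Z -> R^o} :=
  [pred f | `[< linear f /\ continuous f >]].

Lemma dual_pred_submod_closed : submod_closed dual_pred.
Proof.
split=> [|a f g /asboolP[lf cf] /asboolP[lg cg]]; apply/asboolP; split.
- by move=> a x y /=; rewrite scaler0 addr0.
- by move=> x; exact: cvg_cst.
- move=> b x y; rewrite /= !fctE /= lf lg !scalerDr addrACA.
  by rewrite !scalerA (mulrC a b).
- by move=> x; apply: cvgD; [apply: cvgZl_tmp; exact: cf|exact: cg].
Qed.

HB.instance Definition _ :=
  GRing.isSubmodClosed.Build R (Z -> R^o) dual_pred dual_pred_submod_closed.

Record dual := Dual { dual_fun :> Z -> R^o; dualP : dual_fun \in dual_pred }.

HB.instance Definition _ := [isSub of dual for dual_fun].
HB.instance Definition _ := [Choice of dual by <:].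
HB.instance Definition _ := [SubChoice_isSubLmodule of dual by <:].

(* The weak* topology: the coarsest one making every evaluation continuous. *)
HB.instance Definition _ := Topological.copy dual
  (initial_topology (fun f : dual => (dual_fun f : {ptws Z -> R^o}))).

Lemma dual_linear (f : dual) : linear f.
Proof. by have /asboolP[] := dualP f. Qed.

Lemma dual_continuous (f : dual) : continuous f.
Proof. by have /asboolP[] := dualP f. Qed.

HB.instance Definition _ (f : dual) :=
  GRing.isLinear.Build R Z R^o *:%R (dual_fun f) (dual_linear f).

End Dual.
Arguments dual_pred {R} Z.

(* The identification of X^* x Y^* with (X x Y)^*. *)
Section DualProd.
Context {R : realType} {X Y : tvsType R}.

Lemma dual_pair_subproof (p : dual X * dual Y) :
  (fun z : X * Y => p.1 z.1 + p.2 z.2 : R^o) \in dual_pred (X * Y)%type.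
Proof.
apply/asboolP; split=> [a x y|z] /=.
  by rewrite !linearP scalerDr addrACA.
apply: cvgD; apply: continuous_comp; try exact: dual_continuous.
  exact: cvg_fst.
exact: cvg_snd.
Qed.

Definition dual_pair (p : dual X * dual Y) : dual (X * Y)%type :=
  Dual (dual_pair_subproof p).

Lemma dual_pair_bij : bijective dual_pair.
Proof.
have cX (h : dual (X * Y)%type) : (fun x => h (x, 0)) \in dual_pred X.
  apply/asboolP; split=> [a x y|x].
    by rewrite -linearP; congr (h _); congr pair; rewrite /= scaler0 addr0.
  apply: (@continuous_comp _ _ _ (fun x => (x, 0)) h).
    by apply: cvg_pair => /=; [exact: cvg_id|exact: cvg_cst].
  exact: dual_continuous.
have cY (h : dual (X * Y)%type) : (fun y => h (0, y)) \in dual_pred Y.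
  apply/asboolP; split=> [a x y|y].
    by rewrite -linearP; congr (h _); congr pair; rewrite /= scaler0 addr0.
  apply: (@continuous_comp _ _ _ (fun y => (0, y)) h).
    by apply: cvg_pair => /=; [exact: cvg_cst|exact: cvg_id].
  exact: dual_continuous.
exists (fun h => (Dual (cX h), Dual (cY h))).
  move=> [f g]; congr pair; apply/val_inj/funext => z /=.
    by rewrite linear0 addr0.
  by rewrite linear0 add0r.
move=> h; apply/val_inj/funext => -[x y] /=.
by rewrite -linearD; congr (h _); congr pair; rewrite /= ?addr0 ?add0r.
Qed.

End DualProd.

Section ConvexAnalysis.
Context {R : realType}.

Definition affine_subspace (Z : tvsType R) (L : set Z) :=
  L !=set0 /\ forall x y (t : R), L x -> L y -> L ((1 - t) *: x + t *: y).

Definition gen_polyhedral_convex (Z : tvsType R) (D : set Z) :=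
  exists (L : set Z) (p : nat) (zs : 'I_p -> dual Z) (alpha : 'I_p -> R),
    [/\ affine_subspace L, closed L &
        D = [set z | L z /\ forall i, zs i z <= alpha i]].

Definition epi (Z : tvsType R) (f : Z -> \bar R) : set (Z * R^o) :=
  [set p | (f p.1 <= p.2%:E)%E].

Definition gph (X Y : tvsType R) (G : X -> set Y) : set (X * Y) :=
  [set p | G p.1 p.2].

Definition gen_polyhedral_convex_fun (Z : tvsType R) (f : Z -> \bar R) :=
  gen_polyhedral_convex (epi f).

Definition gen_polyhedral_convex_map (X Y : tvsType R) (G : X -> set Y) :=
  gen_polyhedral_convex (gph G).

Definition normal_cone (Z : tvsType R) (C : set Z) (zbar : Z) : set (dual Z) :=
  [set zs | C zbar /\ forall z, C z -> zs (z - zbar) <= 0].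

Definition subdiff (Z : tvsType R) (f : Z -> \bar R) (zbar : Z) :
    set (dual Z) :=
  [set zs | f zbar \is a fin_num /\
    forall z, ((zs (z - zbar))%:E <= f z - f zbar)%E].

(* (z^*, 0) lies in Z^* x R^*, whence the zero functional on R. *)
Definition singular_subdiff (Z : tvsType R) (f : Z -> \bar R) (zbar : Z) :
    set (dual Z) :=
  [set zs | f zbar \is a fin_num /\
    normal_cone (epi f) (zbar, fine (f zbar)) (dual_pair (zs, 0))].

Definition coderivative (X Y : tvsType R) (G : X -> set Y) (xbar : X)
    (ybar : Y) (ys : dual Y) : set (dual X) :=
  [set xs | normal_cone (gph G) (xbar, ybar) (dual_pair (xs, - ys))].

Definition marginal (X Y : tvsType R) (phi : X * Y -> \bar R)
    (G : X -> set Y) (x : X) : \bar R :=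
  ereal_inf [set phi (x, y) | y in G x].

Definition solution_map (X Y : tvsType R) (phi : X * Y -> \bar R)
    (G : X -> set Y) (x : X) : set Y :=
  [set y | G x y /\ marginal phi G x = phi (x, y)].

(* In the next two definitions S stands for the subdifferential, or the
   singular subdifferential, of phi at (xbar, ybar). *)
Definition sum_rule_closure (X Y : tvsType R) (S : set (dual (X * Y)%type))
    (G : X -> set Y) (xbar : X) (ybar : Y) : set (dual X) :=
  closure (\bigcup_(p in dual_pair @^-1` S)
    [set p.1 + u | u in coderivative G xbar ybar p.2]).

Definition closed_sum_slice (X Y : tvsType R) (S : set (dual (X * Y)%type))
    (G : X -> set Y) (xbar : X) (ybar : Y) : set (dual X) :=
  fst @` (dual_pair @^-1`
            closure [set u + v | u in S & v in normal_cone (gph G) (xbar, ybar)]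
          `&` [set p : dual X * dual Y | p.2 = 0]).

End ConvexAnalysis.

(* Main.v *)
Require Import Defs.
From HB Require Import structures.
From mathcomp Require Import all_boot all_order all_algebra.
From mathcomp Require Import all_classical all_reals ereal topology normedtype.
From mathcomp Require Import interval_inference sequences.
Set Implicit Arguments.
Unset Strict Implicit.
Unset Printing Implicit Defensive.
Import Order.TTheory GRing.Theory Num.Theory.
Import numFieldNormedType.Exports.
Local Open Scope classical_set_scope.
Local Open Scope ring_scope.

(** Let [V1] and [V2] be the space of real polynomials normed by
    [sum_i 2^-i |p_i|] and [sum_i |p_i|], and let [f p = p(1)], which is
    continuous on [V2] but not on [V1]: ['X^n] tends to [0] in [V1] while
    [f 'X^n = 1].  Take [X = R], [Y = V1 * V2], let [phi] be the indicator of
    the closed subspace [P = {(x, (0, q))}], and let the graph of [G] be the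
    closed subspace [Q = {(f q, (q, q))}].  At the origin both the
    subdifferential and the singular subdifferential of [phi] are the
    annihilator of [P], and the normal cone of [Q] is the annihilator of [Q].
    Since [P] and [Q] meet only at [0], [mu] is the indicator of [{0}], whose
    subdifferentials are all of [X^*].  If [(u, 0)] is a sum of functionals
    annihilating [P] and [Q], then [u(1) f] is continuous on [V1], so
    [u = 0].  In the closure of the sum all [(u, 0)] appear, because the partial
    sums [sum_(i < n) p_i], continuous on [V1], tend pointwise to [f]. *)

(** * Evaluation and convergence in the weak* topology *)

Section WeakStar.
Context {R : realType} (Z : tvsType R).

Lemma dual_eval_continuous (z : Z) : continuous (fun h : dual Z => h z).
Proof.
move=> h; apply: (@continuous_comp _ _ _
  (fun h : dual Z => (dual_fun h : {ptws Z -> R^o})) (fun f => f z)).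
  exact: initial_continuous.
exact: proj_continuous.
Qed.

(** The weak* topology is induced by the pointwise one, so each open neighbourhood of [l] is the
    preimage of a pointwise open set. *)
Lemma dual_cvg (T : Type) (F : set_system T) (FF : Filter F)
    (h : T -> dual Z) (l : dual Z) :
  (forall z, h t z @[t --> F] --> l z) -> h t @[t --> F] --> l.
Proof.
move=> hl A; rewrite nbhsE => -[B [[C oC <-] lC] BA].
have hC : {ptws, (fun t => dual_fun (h t)) @ F --> dual_fun l}.
  exact/pointwise_cvgP.
have /hC : nbhs (dual_fun l : {ptws Z -> R^o}) C.
  by apply: open_nbhs_nbhs; split.
by move=> FC; apply: (@filterS _ F _ _ _ _ FC) => t; exact: BA.
Qed.

Lemma dual_sumE (I : Type) (r : seq I) (h : I -> dual Z) (z : Z) :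
  (\sum_(i <- r) h i) z = \sum_(i <- r) h i z.
Proof. by elim/big_rec2: _ => // i x y _ <-. Qed.

End WeakStar.

(** * Normal cones and subdifferentials attached to a linear subspace *)

Section Subspace.
Context {R : realType} {Z : tvsType R}.

Definition linear_subspace (P : set Z) :=
  P 0 /\ forall (a : R) x y, P x -> P y -> P (a *: x + y).

Definition annihilator (P : set Z) : set (dual Z) :=
  [set h | forall z, P z -> h z = 0].

Definition indicator (P : set Z) (z : Z) : \bar R :=
  if `[< P z >] then 0%E else +oo%E.

Lemma indicator_in (P : set Z) z : P z -> indicator P z = 0%E.
Proof. by rewrite /indicator => /asboolT ->. Qed.

Lemma indicator_notin (P : set Z) z : ~ P z -> indicator P z = +oo%E.
Proof. by rewrite /indicator => /asboolF ->. Qed.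

Lemma epi_indicator (P : set Z) :
  epi (indicator P) = [set w | P w.1 /\ 0 <= w.2].
Proof.
apply/seteqP; split=> -[z t] /=; rewrite /epi /=; last first.
  by move=> [/indicator_in -> t0]; rewrite lee_fin.
have [Pz|nPz] := pselect (P z); first by rewrite indicator_in// lee_fin.
by rewrite indicator_notin// leye_eq.
Qed.

Variables (P : set Z) (sP : linear_subspace P).

Lemma linear_subspace_affine : affine_subspace P.
Proof.
have [P0 PD] := sP; split; first by exists 0.
move=> x y t Px Py; apply: (PD _ _ _ Px).
by have := PD t y 0 Py P0; rewrite addr0.
Qed.

(** A subspace contains [- z] along with [z], so an upper bound by 0 forces equality. *)
Lemma subspace_le0P (h : dual Z) :
  (forall z, P z -> h z <= 0) <-> annihilator P h.
Proof.
have [P0 PD] := sP; split=> [hP z Pz|hP z /hP ->//].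
apply/eqP; rewrite eq_le hP//= -oppr_le0 -linearN hP//.
by rewrite -scaleN1r -[_ *: _]addr0; exact: PD.
Qed.

Lemma normal_cone_subspace : normal_cone P 0 = annihilator P.
Proof.
apply/seteqP; split=> h; rewrite /normal_cone /= -subspace_le0P.
  by move=> [_ hP] z /hP; rewrite subr0.
by move=> hP; split; [case: sP|move=> z /hP; rewrite subr0].
Qed.

Lemma subdiff_indicator : subdiff (indicator P) 0 = annihilator P.
Proof.
have P0 := sP.1.
apply/seteqP; split=> h; rewrite /subdiff /= -subspace_le0P indicator_in//.
  move=> [_ hP] z Pz; have := hP z.
  by rewrite subr0 indicator_in// sube0 lee_fin.
move=> hP; split=> // z; rewrite subr0 sube0.
have [Pz|nPz] := pselect (P z); first by rewrite indicator_in// lee_fin hP.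
by rewrite indicator_notin// leey.
Qed.

Lemma singular_subdiff_indicator :
  singular_subdiff (indicator P) 0 = annihilator P.
Proof.
have P0 := sP.1.
apply/seteqP; split=> h;
    rewrite /singular_subdiff /normal_cone /= -subspace_le0P indicator_in//.
  rewrite epi_indicator => -[_ [_ hP]] z Pz.
  by have := hP (z, 0) (conj Pz (lexx _)); rewrite /= !subr0 addr0.
move=> hP; split=> //; rewrite epi_indicator; split=> //= -[z t] [/= Pz _].
by rewrite subr0 addr0 hP.
Qed.

End Subspace.

(** * Polyhedral convexity and marginal functions for subspaces *)

Lemma gen_polyhedral_convex_subspace (R : realType) (Z : tvsType R)
    (P : set Z) :
  linear_subspace P -> closed P -> gen_polyhedral_convex P.
Proof.
(* With [L = P] there are no inequalities: ['I_0] is empty and the functionals are dummies. *)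
move=> sP cP; exists P, 0%N, (fun=> 0), (fun=> 0).
split=> //; first exact: linear_subspace_affine.
by apply/seteqP; split=> [z Pz|z []//]; split=> // -[].
Qed.

Lemma idfun_dual (R : realType) : (fun x : R^o => x) \in dual_pred R^o.
Proof. by apply/asboolP; split=> // x; exact: cvg_id. Qed.

Definition dual_id (R : realType) : dual R^o := Dual (idfun_dual R).

Lemma gen_polyhedral_convex_indicator (R : realType) (Z : tvsType R)
    (P : set Z) :
  linear_subspace P -> closed P -> gen_polyhedral_convex_fun (indicator P).
Proof.
move=> sP cP.
(* The epigraph is the subspace [P * R] cut by the single inequality [- t <= 0]. *)
exists (fst @^-1` P), 1%N, (fun=> dual_pair (0, - dual_id R)), (fun=> 0).
split.
- split; first by exists 0; case: sP.
  move=> x y t Px Py; exact: (linear_subspace_affine sP).2.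
- by apply: preimage_closed => // z _; exact: cvg_fst.
- rewrite epi_indicator; apply/seteqP; split=> -[z t] /= [Pz] => [t0|/(_ ord0)].
    by split=> // _; rewrite add0r oppr_le0.
  by rewrite add0r oppr_le0.
Qed.

(** The infimum is 0 as soon as one feasible [y] has [(x, y)] in [P]; otherwise every value is
    [+oo], as is the infimum over an empty [G x]. *)
Lemma marginal_indicator (R : realType) (X Y : tvsType R) (P : set (X * Y))
    (G : X -> set Y) :
  marginal (indicator P) G = indicator [set x | exists2 y, G x y & P (x, y)].
Proof.
apply/funext => x; rewrite /marginal.
have [Px|nPx] := pselect (exists2 y, G x y & P (x, y)).
  rewrite indicator_in//; apply/eqP; rewrite eq_le; apply/andP; split.
    have [y Gy Py] := Px; apply: ereal_inf_lbound; exists y => //.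
    exact: indicator_in.
  apply: le_ereal_inf_tmp => _ [y _ <-]; rewrite /indicator.
  by case: ifP => // _; exact: leey.
rewrite indicator_notin//; apply/ereal_inf_pinfty => _ [y Gy <-].
by rewrite indicator_notin// => Py; apply: nPx; exists y.
Qed.

Lemma dual_regularE (R : realType) (u : dual R^o) (x : R) : u x = x * u 1.
Proof. by rewrite -[in LHS](mulr1 x) -[x * 1]/(x *: 1) linearZ. Qed.

(* An alias, so that each weight [c] gives its own normed space; elements of
   different [wpoly c] can be compared as polynomials. *)
Definition wpoly (R : realType) (c : {posnum R}) : Type := {poly R}.

(** * Polynomials under a weighted l1 norm *)

Section WPoly.
Context {R : realType} {c : {posnum R}}.

HB.instance Definition _ := GRing.Lmodule.on (wpoly c).

Definition wnorm (p : wpoly c) : R :=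
  \sum_(i < size (p : {poly R})) `|(p : {poly R})`_i| * c%:num ^+ i.

(** Coefficients beyond the degree vanish, so polynomials of different sizes can be summed over a
    common range. *)
Lemma wnorm_widen n (p : {poly R}) : (size p <= n)%N ->
  wnorm p = \sum_(i < n) `|p`_i| * c%:num ^+ i.
Proof.
move=> pn; rewrite /wnorm (big_ord_widen n (fun i => `|p`_i| * c%:num ^+ i)) //.
rewrite big_mkcond; apply: eq_bigr => i _; case: ltnP => // /(nth_default 0) ->.
by rewrite normr0 mul0r.
Qed.

Lemma wnormD (p q : wpoly c) : wnorm (p + q) <= wnorm p + wnorm q.
Proof.
pose n := maxn (size (p : {poly R})) (size (q : {poly R})).
rewrite (@wnorm_widen n (p + q)) ?size_polyD//.
rewrite (@wnorm_widen n p) ?leq_maxl// (@wnorm_widen n q) ?leq_maxr//.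
rewrite -big_split; apply: ler_sum => i _ /=.
by rewrite -mulrDl coefD ler_wpM2r// ler_normD.
Qed.

Lemma wnormZ (a : R) (p : wpoly c) : wnorm (a *: p) = `|a| * wnorm p.
Proof.
rewrite (@wnorm_widen (size (p : {poly R})) (a *: p)) ?size_scale_leq//.
by rewrite mulr_sumr; apply: eq_bigr => i _; rewrite coefZ normrM mulrA.
Qed.

Lemma wnorm_ge0 (p : wpoly c) : 0 <= wnorm p.
Proof. exact: sumr_ge0. Qed.

(** A single term of a sum of nonnegative terms. This gives both definiteness of the norm and
    continuity of each coefficient. *)
Lemma le_coef_wnorm i (p : wpoly c) :
  `|(p : {poly R})`_i| * c%:num ^+ i <= wnorm p.
Proof.
case: (ltnP i (size (p : {poly R}))) => [ip|pi].
  by rewrite /wnorm (bigD1 (Ordinal ip))//= lerDl sumr_ge0.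
have -> : (p : {poly R})`_i = 0 :> R by rewrite nth_default.
by rewrite normr0 mul0r wnorm_ge0.
Qed.

Lemma wnorm0_eq0 (p : wpoly c) : wnorm p = 0 -> p = 0.
Proof.
move=> p0; apply/polyP => i; have := le_coef_wnorm i p.
by rewrite p0 coef0 pmulr_lle0// normr_le0 => /eqP.
Qed.

HB.instance Definition _ :=
  Lmodule_isNormed.Build R (wpoly c) wnormD wnormZ wnorm0_eq0.

Lemma norm_wpolyXn n : `|('X^n : {poly R}) : wpoly c| = c%:num ^+ n.
Proof.
rewrite [LHS]/(wnorm _) /wnorm size_polyXn big_ord_recr/= big1 => [|i _].
  by rewrite add0r coefXn eqxx normr1 mul1r.
by rewrite coefXn ltn_eqF ?normr0 ?mul0r.
Qed.

Lemma bounded_dual (h : wpoly c -> R^o) (M : R) : linear h ->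
  (forall p, `|h p| <= M * `|p|) -> h \in dual_pred (wpoly c).
Proof.
move=> lh hM; apply/asboolP; split=> //.
pose hl : {linear wpoly c -> R^o} :=
  HB.pack h (GRing.isLinear.Build R (wpoly c) R^o *:%R h lh).
apply: (@bounded_linear_continuous _ _ _ hl); apply/linear_boundedP.
near=> r => p; apply: le_trans (hM p) _; apply: ler_wpM2r => //.
by near: r; apply: nbhs_pinfty_ge; exact: num_real.
Unshelve. all: by end_near. Qed.

Lemma coef_dual_subproof i :
  (fun p : wpoly c => (p : {poly R})`_i : R^o) \in dual_pred (wpoly c).
Proof.
apply: (@bounded_dual _ (c%:num ^- i)) => [a p q|p].
  by rewrite coefD coefZ.
by rewrite mulrC ler_pdivlMr//; exact: le_coef_wnorm.
Qed.

Definition coef_dual i : dual (wpoly c) := Dual (coef_dual_subproof i).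

End WPoly.

(** * The two subspaces and the functionals on them *)

Section Counterexample.
Variable R : realType.

Definition half_pos : {posnum R} := (2^-1)%:pos.
Definition one_pos : {posnum R} := 1%:pos.

Local Notation V1 := (wpoly half_pos).
Local Notation V2 := (wpoly one_pos).
Local Notation X := (R^o)%type.
Local Notation Y := (V1 * V2)%type.

Lemma horner1_dual_subproof :
  (fun p : V2 => (p : {poly R}).[1] : R^o) \in dual_pred V2.
Proof.
apply: (@bounded_dual _ _ _ 1) => [a p q|p]; first by rewrite hornerD hornerZ.
rewrite mul1r [leRHS]/(wnorm _) /wnorm horner_coef.
apply: le_trans (ler_norm_sum _ _ _) _; apply: ler_sum => i _.
by rewrite normrM normrX normr1.
Qed.

Definition horner1 : dual V2 := Dual horner1_dual_subproof.

(** Truncations of [p |-> p.[1]], continuous for every weight. The weight stays a parameter because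
    copies on both [V1] and [V2] are used. *)
Definition partial_sum (c : {posnum R}) (n : nat) : dual (wpoly c) :=
  \sum_(i < n) coef_dual i.

Lemma partial_sumE c n (p : wpoly c) :
  partial_sum c n p = \sum_(i < n) (p : {poly R})`_i.
Proof. by rewrite /partial_sum dual_sumE. Qed.

Lemma partial_sum_eventually (p : V2) :
  \forall n \near \oo, partial_sum one_pos n p = horner1 p.
Proof.
exists (size (p : {poly R})) => // n /= pn.
rewrite partial_sumE /= horner_coef.
rewrite (big_ord_widen n (fun i => p`_i * 1 ^+ i))//.
rewrite [RHS]big_mkcond; apply: eq_bigr => i _; rewrite expr1n mulr1.
by case: ltnP => // /(nth_default 0).
Qed.

Definition zero_fst : set (X * Y) := [set z | z.2.1 = 0].
Definition diagonal_map (x : X) : set Y :=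
  [set y | y.1 = y.2 :> {poly R} /\ x = horner1 y.2].

Lemma zero_fst_subspace : linear_subspace zero_fst.
Proof.
split=> // a x y Px Py.
by rewrite /zero_fst /= Px Py scaler0 addr0.
Qed.

Lemma zero_fst_closed : closed zero_fst.
Proof.
apply: (@preimage_closed _ _ (fun z : X * Y => z.2.1) [set 0]).
  move=> z _; apply: continuous_comp; first exact: cvg_snd.
  exact: cvg_fst.
exact/accessible_closed_set1/hausdorff_accessible/norm_hausdorff.
Qed.

Lemma gph_diagonal_subspace : linear_subspace (gph diagonal_map).
Proof.
split; first by split=> //=; rewrite horner0.
move=> a [x [p q]] [x' [p' q']] [/= pq ->] [/= pq' ->]; split=> /=.
  by rewrite pq pq'.
by rewrite hornerD hornerZ.
Qed.

(** The graph is an intersection of kernels of continuous functionals: [x - q.[1]], and [p_i - q_i]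
    for every [i]. *)
Lemma gph_diagonal_closed : closed (gph diagonal_map).
Proof.
have -> : gph diagonal_map = \bigcap_(h in [set h : dual (X * Y)%type |
    h = dual_pair (dual_id R, dual_pair (0, - horner1)) \/
    exists i, h = dual_pair (0, dual_pair (coef_dual i, - coef_dual i))])
    (h @^-1` [set 0]).
  apply/seteqP; split=> [[x [p q]] [/= pq ->] h|[x [p q]] H] /=.
    move=> [->|[i ->]] /=; first by rewrite add0r subrr.
    by rewrite add0r pq subrr.
  split=> /=; last first.
    have /= := H _ (or_introl erefl).
    by rewrite add0r => /eqP; rewrite subr_eq0 => /eqP.
  apply/polyP => i.
  have /= := H _ (or_intror (ex_intro _ i erefl)).
  by rewrite add0r => /eqP; rewrite subr_eq0 => /eqP.
apply: closed_bigI => h _; apply: preimage_closed; last exact: closed_eq.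
by move=> z _; exact: dual_continuous.
Qed.

Lemma marginal_diagonal :
  marginal (indicator zero_fst) diagonal_map = indicator [set 0].
Proof.
rewrite marginal_indicator; congr indicator; apply/seteqP; split=> x /=.
  by move=> [[p q] [/= <- ->]]; rewrite /zero_fst /= => ->; rewrite horner0.
by move=> ->; exists 0 => //; split=> //=; rewrite horner0.
Qed.

(** * Comparison of the two dual formulas at the origin *)

Lemma annihilator0 : annihilator [set (0 : X)] = setT.
Proof. by apply/seteqP; split=> // h _ _ ->; exact: linear0. Qed.

Lemma cvg_wpolyXn0 : (('X^n : {poly R}) : V1) @[n --> \oo] --> (0 : V1).
Proof.
apply: norm_cvg0; under eq_fun do rewrite norm_wpolyXn.
by apply: cvg_expr; rewrite ger0_norm//= invf_lt1 ?ltr1n.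
Qed.

Lemma sum_rule_closure_eval1 :
  sum_rule_closure (annihilator zero_fst) diagonal_map 0 0
  `<=` [set u | u 1 = 0].
Proof.
rewrite /sum_rule_closure.
(* Evaluation at 1 is weak* continuous, so the condition need only be checked before taking the
   closure. *)
have cl : closed [set u : dual X | u 1 = 0].
  apply: (@preimage_closed _ _ (fun u : dual X => u 1) [set 0]).
    by move=> u _; exact: dual_eval_continuous.
  exact: closed_eq.
rewrite [X in _ `<=` X](closure_id _).1//; apply: closureS.
move=> _ [[v w] /= vw0 [u + <-]].
rewrite /coderivative /= (normal_cone_subspace gph_diagonal_subspace) => uwQ.
have v1 : v 1 = 0.
  by have := vw0 (1, 0) erefl; rewrite /= linear0 addr0.
(* [(u, - w)] kills the graph point [(b.[1], (b, b))], and [w] kills [(0, b)], since [(0, (0, b))]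
   lies in [zero_fst]. *)
have uw (b : {poly R}) : u b.[1] = w (b, 0).
  have := uwQ (b.[1], (b, b)) (conj erefl erefl).
  move=> /= /eqP; rewrite subr_eq0 => /eqP ->.
  have := vw0 (0, (0, b)) erefl; rewrite /= linear0 add0r => w0.
  rewrite -[w (b, 0)]addr0 -w0 -linearD.
  by congr (w (_, _)); rewrite ?addr0 ?add0r.
rewrite /= fctE v1 add0r.
(* With [b = 'X^n], the values [w ('X^n, 0)] are constantly [u 1], yet tend to [w 0 = 0] by
   continuity. *)
have /cvg_comp /(_ (@dual_continuous _ _ w _)) :
    (('X^n : {poly R}) : V1, 0 : V2) @[n --> \oo] --> ((0, 0) : V1 * V2).
  exact: (@cvg_pair _ _ _ \oo (nbhs (0 : V1)) (nbhs (0 : V2))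
    _ _ _ _ _ cvg_wpolyXn0 (cvg_cst _)).
rewrite linear0 (_ : _ \o _ = fun=> u 1); last first.
  by apply/funext => n; rewrite -[LHS]uw hornerXn expr1n.
move=> /(cvg_unique _ (cvg_cst _)); exact.
Qed.

Lemma closed_sum_sliceT :
  closed_sum_slice (annihilator zero_fst) diagonal_map 0 0 = setT.
Proof.
apply/seteqP; split=> // u _; exists (u, 0) => //; split=> //=.
rewrite (normal_cone_subspace gph_diagonal_subspace).
pose t := u 1.
(* [a n] sees only the [V1] coordinate, so it annihilates [zero_fst]. [b n] cancels that coordinate
   and is corrected on [V2] to vanish on the graph, where [u] contributes [t * q.[1]]. Their sum is
   [(u, (0, t *: (partial_sum n - horner1)))]. *)
pose a n : dual (X * Y)%type :=
  dual_pair (0, dual_pair (t *: partial_sum half_pos n, 0)).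
pose b n : dual (X * Y)%type :=
  dual_pair (u, dual_pair (- (t *: partial_sum half_pos n),
                           t *: (partial_sum one_pos n - horner1))).
apply: (@closed_cvg _ _ \oo _ (fun n => a n + b n)).
- exact: closed_closure.
- apply: nearW => n; apply: subset_closure; exists (a n).
    move=> [x [p q]]; rewrite /zero_fst /= => ->.
    by rewrite !fctE linear0 scaler0 !addr0.
  exists (b n) => //.
  move=> [x [p q]] [/= pq ->].
  rewrite /= !fctE dual_regularE -/t !partial_sumE pq.
  by rewrite scalerBr addKr -[t *: _]/(t * _) mulrC subrr.
- apply: dual_cvg => -[x [p q]] /=.
  (* At each fixed [q] the truncations eventually equal [q.[1]], so the error term is eventually
     zero. *)
  apply: cvg_near_cst; apply: filterS (partial_sum_eventually q) => n qn.
  by rewrite !fctE qn /= subrr scaler0 add0r !addr0 addrCA subrr addr0.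
Qed.

Lemma sum_rule_closure_neqT :
  sum_rule_closure (annihilator zero_fst) diagonal_map 0 0 <> setT.
Proof.
move=> AT; have := @sum_rule_closure_eval1 (dual_id R).
by rewrite AT => /(_ I) /eqP; rewrite /= oner_eq0.
Qed.

End Counterexample.

Theorem theorem3p2 (R : realType) :
  exists (X Y : tvsType R) (phi : X * Y -> \bar R) (G : X -> set Y)
         (xbar : X) (ybar : Y),
    let mu := marginal phi G in
    let A := sum_rule_closure (subdiff phi (xbar, ybar)) G xbar ybar in
    let B := closed_sum_slice (subdiff phi (xbar, ybar)) G xbar ybar in
    let Ainf :=
      sum_rule_closure (singular_subdiff phi (xbar, ybar)) G xbar ybar in
    let Binf :=
      closed_sum_slice (singular_subdiff phi (xbar, ybar)) G xbar ybar in
    [/\ hausdorff_space X /\ hausdorff_space Y,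
        gen_polyhedral_convex_fun phi /\ gen_polyhedral_convex_map G,
        mu xbar \is a fin_num /\ solution_map phi G xbar ybar,
        [/\ A `<=` subdiff mu xbar, subdiff mu xbar = B & A <> B] &
        [/\ Ainf `<=` singular_subdiff mu xbar,
            singular_subdiff mu xbar = Binf & Ainf <> Binf]].
Proof.
have s0 : linear_subspace [set (0 : R^o)].
  by split=> // a x y -> ->; rewrite scaler0 addr0.
exists R^o, (wpoly (half_pos R) * wpoly (one_pos R))%type.
have [sP cP] := (@zero_fst_subspace R, @zero_fst_closed R).
have [sQ cQ] := (@gph_diagonal_subspace R, @gph_diagonal_closed R).
exists (indicator (@zero_fst R)), (@diagonal_map R), 0, 0 => /=.
(* Ordinary and singular subdifferentials become the same annihilators, so both chains of claims
   coincide. The inclusions are then trivial, the right-hand side being the whole dual. *)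
rewrite (subdiff_indicator sP) (singular_subdiff_indicator sP).
rewrite marginal_diagonal.
rewrite (subdiff_indicator s0) (singular_subdiff_indicator s0).
rewrite annihilator0 closed_sum_sliceT.
have nT := @sum_rule_closure_neqT R.
split=> //.
- split; first exact: gen_polyhedral_convex_indicator sP cP.
  exact: gen_polyhedral_convex_subspace sQ cQ.
- rewrite indicator_in//; split=> //; split.
    by split=> //=; rewrite horner0.
  by rewrite marginal_diagonal !indicator_in.
Qed.
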